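(* Let $\mathcal{U}$ be a strategic $(p^+)$-filter on $E$. Then every analytic set $\mathbb{A}\subseteq 2^\omega\times E^{[\infty]}$ is perfectly $\mathcal{U}$-strategically Ramsey.
   Context: $F$ is a countable field and $E$ a countably infinite-dimensional $F$-vector space with fixed basis $(e_n)$; $\mathrm{supp}(v)$ is the set of indices of nonzero coefficients of $v\ne0$. Block sequences: sequences of nonzero vectors with $\max\mathrm{supp}(x_n)<\min\mathrm{supp}(x_{n+1})$; $E^{[\infty]}$ (Polish, subspace of $E^\omega$) and $E^{[<\infty]}$ are the infinite and finite ones. $Y\preceq X$ iff $\langle Y\rangle\subseteq\langle X\rangle$; $Y\preceq^*X$ iff some tail of $Y$ is $\preceq X$. Family: nonempty subset of $E^{[\infty]}$ upward closed under $\preceq^*$; filter: family whose any two members have a common $\preceq$-lower bound in it; $\mathcal{H}\restriction X=\{Y\in\mathcal{H}:Y\preceq X\}$. Full: whenever $D\subseteq E$ and $X\in\mathcal{H}$ are such that every $Y\in\mathcal{H}\restriction X$ has some $Z\preceq Y$ with $\langle Z\rangle\subseteq D$, there is $Z\in\mathcal{H}\restriction X$ with $\langle Z\rangle\subseteq D$. $(p)$: every $\preceq$-decreasing sequence in $\mathcal{H}$ has a member of $\mathcal{H}$ that is $\preceq^*$ each term; $(p^+)$-filter: full filter with $(p)$. Strategic: whenever $X\in\mathcal{H}$ and $\alpha$ is a strategy for II in $G[X]$, some outcome of $\alpha$ lies in $\mathcal{H}$. Games for $\vec x\in E^{[<\infty]}$, $X\in E^{[\infty]}$: in $F[\vec x,X]$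 I plays $n_k\in\omega$, II plays nonzero $y_k\in\langle X\rangle$ with $n_k<\min\mathrm{supp}(y_k)$; in $G[\vec x,X]$ I plays $Y_k\in E^{[\infty]}$, $Y_k\preceq X$, II plays nonzero $y_k\in\langle Y_k\rangle$; II's moves are supported above $\vec x$ and form a block sequence; outcome $\vec x^\frown(y_k)$; $G[X]=G[\emptyset,X]$. $[\sigma]$ is the set of outcomes of plays where I follows $\sigma$. $\mathbb{S}$: nonempty perfect subtrees of $2^{<\omega}$ ordered by inclusion; $[p]$ the branches of $p$. $\mathbb{A}$ is perfectly $\mathcal{U}$-strategically Ramsey if for every $\vec x\in E^{[<\infty]}$, $X\in\mathcal{U}$ and $p\in\mathbb{S}$ there are $Y\in\mathcal{U}\restriction X$ and $q\le p$ such that either (i) I has a strategy $\sigma$ in $F[\vec x,Y]$ with $([q]\times[\sigma])\cap\mathbb{A}=\emptyset$, or (ii) for every $f\in[q]$, II has a strategy in $G[\vec x,Y]$ all of whose outcomes lie in $\mathbb{A}_f=\{Z:(f,Z)\in\mathbb{A}\}$. *)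

(* Defs.v *)
From HB Require Import structures.
From mathcomp Require Import all_boot all_order all_algebra.
From mathcomp Require Import finmap.
Set Implicit Arguments. Unset Strict Implicit. Unset Printing Implicit Defensive.
Import GRing.Theory.
Local Open Scope ring_scope.

Section Defs.
Variable F : countFieldType.

(* E = the F-vector space with basis (e_n)_{n : nat}: a vector is its
   finitely supported coefficient function n |-> coefficient of e_n. *)
Definition vec := {fsfun nat -> F with 0}.

Definition vzero : vec := [fsfun].

Definition nonzero (v : vec) : Prop := exists n, v n != 0.

Definition vlt (x y : vec) : Prop :=
  forall i j, x i != 0 -> y j != 0 -> (i < j)%N.

Definition above (n : nat) (y : vec) : Prop := forall j, y j != 0 -> (n < j)%N.

Definition blockseq (X : nat -> vec) : Prop :=
  (forall n, nonzero (X n)) /\ (forall n, vlt (X n) (X n.+1)).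

Definition fblockseq (xs : seq vec) : Prop :=
  (forall v, v \in xs -> nonzero v) /\
  (forall i, (i.+1 < size xs)%N -> vlt (nth vzero xs i) (nth vzero xs i.+1)).

Definition inspan (X : nat -> vec) (v : vec) : Prop :=
  exists (n : nat) (c : nat -> F),
    forall j, v j = \sum_(i < n) c i * X i j.

Definition ble (Y X : nat -> vec) : Prop :=
  forall v, inspan Y v -> inspan X v.

Definition blestar (Y X : nat -> vec) : Prop :=
  exists m, ble (fun n => Y (n + m)%N) X.

Definition bset := (nat -> vec) -> Prop.

Definition family (H : bset) : Prop :=
  (exists X, H X) /\ (forall X, H X -> blockseq X) /\
  (forall X Y, H Y -> blockseq X -> blestar Y X -> H X).

Definition filter (H : bset) : Prop :=
  family H /\ forall X Y, H X -> H Y -> exists Z, H Z /\ ble Z X /\ ble Z Y.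

Definition restr (H : bset) (X : nat -> vec) : bset :=
  fun Y => H Y /\ ble Y X.

Definition full (H : bset) : Prop :=
  forall (D : vec -> Prop) X, H X ->
    (forall Y, restr H X Y ->
       exists Z, blockseq Z /\ ble Z Y /\ (forall v, inspan Z v -> D v)) ->
    exists Z, restr H X Z /\ (forall v, inspan Z v -> D v).

Definition property_p (H : bset) : Prop :=
  forall Xs : nat -> nat -> vec,
    (forall n, H (Xs n)) -> (forall n, ble (Xs n.+1) (Xs n)) ->
    exists X, H X /\ forall n, blestar X (Xs n).

Definition pplus_filter (H : bset) : Prop :=
  filter H /\ full H /\ property_p H.

Definition concat_seq (xs : seq vec) (ys : nat -> vec) : nat -> vec :=
  fun n => if (n < size xs)%N then nth vzero xs n else ys (n - size xs)%N.

(* ---- The game G[xs, X] ----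
   A strategy for II is a function from the history of I's moves
   (Y_0, ..., Y_k) to II's k-th move y_k (II's earlier moves are determined by
   the strategy). *)
Definition stratII := seq (nat -> vec) -> vec.

Definition respII (alpha : stratII) (Ys : nat -> nat -> vec) (k : nat) : vec :=
  alpha (mkseq Ys k.+1).

Definition legalI_G (X : nat -> vec) (Ys : nat -> nat -> vec) : Prop :=
  forall k, blockseq (Ys k) /\ ble (Ys k) X.

Definition is_stratII_G (xs : seq vec) (X : nat -> vec) (alpha : stratII) : Prop :=
  forall Ys, legalI_G X Ys ->
    forall k,
      nonzero (respII alpha Ys k) /\
      inspan (Ys k) (respII alpha Ys k) /\
      (forall x, x \in xs -> vlt x (respII alpha Ys k)) /\
      (forall i, (i < k)%N -> vlt (respII alpha Ys i) (respII alpha Ys k)).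

Definition outcomeII_G (xs : seq vec) (X : nat -> vec) (alpha : stratII)
    (Z : nat -> vec) : Prop :=
  exists Ys, legalI_G X Ys /\ Z =1 concat_seq xs (respII alpha Ys).

(* ---- The game F[xs, X] ----
   A strategy for I maps II's previous moves (y_0, ..., y_{k-1}) to n_k. *)
Definition stratI := seq vec -> nat.

Definition outcomesI_F (xs : seq vec) (X : nat -> vec) (sigma : stratI)
    (Z : nat -> vec) : Prop :=
  exists ys : nat -> vec,
    (forall k,
       nonzero (ys k) /\ inspan X (ys k) /\
       above (sigma (mkseq ys k)) (ys k) /\
       (forall x, x \in xs -> vlt x (ys k)) /\
       (forall i, (i < k)%N -> vlt (ys i) (ys k))) /\
    Z =1 concat_seq xs ys.

Definition strategic (H : bset) : Prop :=
  forall X alpha, H X -> is_stratII_G [::] X alpha ->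
    exists Z, outcomeII_G [::] X alpha Z /\ H Z.

Definition tree (p : seq bool -> Prop) : Prop :=
  p [::] /\ forall s b, p (rcons s b) -> p s.

Definition perfect_tree (p : seq bool -> Prop) : Prop :=
  tree p /\
  forall s, p s -> exists t, prefix s t /\ p (rcons t false) /\ p (rcons t true).

Definition tree_le (q p : seq bool -> Prop) : Prop := forall s, q s -> p s.

Definition branch (p : seq bool -> Prop) (f : nat -> bool) : Prop :=
  forall n, p (mkseq f n).

(* ---- analytic subsets of 2^omega x E^omega ----
   E carries the discrete topology, 2^omega x E^omega the product topology;
   A is analytic iff it is empty or a continuous image of the Baire space. *)
Definition pt := ((nat -> bool) * (nat -> vec))%type.

Definition baire_continuous (g : (nat -> nat) -> pt) : Prop :=
  forall (a : nat -> nat) (n : nat), exists m : nat,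
    forall b : nat -> nat, (forall i, (i < m)%N -> b i = a i) ->
      forall i, (i < n)%N -> (g b).1 i = (g a).1 i /\ (g b).2 i = (g a).2 i.

Definition analytic (A : pt -> Prop) : Prop :=
  (forall z, ~ A z) \/
  exists g : (nat -> nat) -> pt, baire_continuous g /\
    (forall a, A (g a)) /\ (forall z, A z -> exists a, g a = z).

Definition perfectly_strat_Ramsey (U : bset) (A : pt -> Prop) : Prop :=
  forall (xs : seq vec) (X : nat -> vec) (p : seq bool -> Prop),
    fblockseq xs -> U X -> perfect_tree p ->
    exists (Y : nat -> vec) (q : seq bool -> Prop),
      restr U X Y /\ perfect_tree q /\ tree_le q p /\
      ((exists sigma : stratI,
          forall f Z, branch q f -> outcomesI_F xs Y sigma Z -> ~ A (f, Z)) \/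
       (forall f, branch q f ->
          exists alpha : stratII, is_stratII_G xs Y alpha /\
            forall Z, outcomeII_G xs Y alpha Z -> A (f, Z))).

End Defs.

(* Main.v *)
Require Import Defs.
From mathcomp Require Import all_boot all_order all_algebra.
From mathcomp Require Import finmap boolp zify.
Set Implicit Arguments. Unset Strict Implicit. Unset Printing Implicit Defensive.

(* Without the perfect-set parameter, the argument is this.  Call [(x, s)]
   avoidable if I can keep the outcome out of the part of the analytic set coded
   by extensions of the finite code [s].  From a non-avoidable [(x, s)], II
   plays an open game to reach a non-avoidable [(w, s n)], and iterating these
   games produces a code of the outcome.
   With the parameter, every countable family of statements about
   the parameter [f] is first decided by finite initial segments of [f] on a
   smaller perfect set, by fusion over hereditary properties of perfect trees.
   I's single strategy then only has to take a maximum over the finitely many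
   nodes of one level, while the members of [U] involved are diagonalized using
   [(p)].
   Everything reduces to fullness for sets [D_f] depending continuously on
   [f].  There a finite block sequence [w] is accepted by a tree [r] if no
   subtree of [r] and member of [U] exclude every [Z] with the span of [w, Z]
   inside [D_f].  By fullness, II can play in [G] so that each accepted [w] is
   extended to an accepted one while [r] is refined along a fusion sequence; an
   outcome in [U], given by strategicality, has its span in [D_f] for all
   branches [f] of the fusion. *)

(** * Perfect trees and fusion *)

Notation btree := (seq bool -> Prop).

Definition subtree (p : btree) (t : seq bool) : btree :=
  fun s => p s /\ (prefix s t || prefix t s).

Definition agree_upto T (m : nat) (a b : nat -> T) : Prop :=
  forall i, i < m -> a i = b i.

Lemma agree_uptoW T m n (a b : nat -> T) :
  m <= n -> agree_upto n a b -> agree_upto m a b.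
Proof. by move=> mn ab i im; apply: ab; apply: leq_trans mn. Qed.

Lemma agree_upto_mkseq T m (a b : nat -> T) :
  agree_upto m a b -> mkseq a m = mkseq b m.
Proof.
move=> ab; apply/eq_in_map => i; rewrite mem_iota /= => im.
exact: ab.
Qed.

Lemma mkseq_agree_upto T m (a b : nat -> T) :
  mkseq a m = mkseq b m -> agree_upto m a b.
Proof.
move=> ab i im; have := congr1 (fun s => nth (a i) s i) ab.
by rewrite !nth_mkseq.
Qed.

Lemma take_mkseq T (f : nat -> T) m n : m <= n -> take m (mkseq f n) = mkseq f m.
Proof. by move=> mn; rewrite /mkseq -map_take take_iota (minn_idPl mn). Qed.

Lemma prefix_mkseq (T : eqType) (f : nat -> T) m n :
  m <= n -> prefix (mkseq f m) (mkseq f n).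
Proof. by move=> mn; rewrite -(take_mkseq f mn) prefix_take. Qed.

Lemma prefix_comparable (T : eqType) (s t u : seq T) :
  prefix s u -> prefix t u -> size s <= size t -> prefix s t.
Proof.
rewrite !prefixE => /eqP su /eqP tu st.
by rewrite -tu take_takel // su.
Qed.

Lemma eq_prefix_size (T : eqType) (s t : seq T) :
  prefix s t -> size t <= size s -> s = t.
Proof. by rewrite prefixE => /eqP {2}<- ts; rewrite take_oversize. Qed.

Lemma subtreeW p t : tree_le (subtree p t) p.
Proof. by move=> s []. Qed.

Lemma subtreeS p q t : tree_le q p -> tree_le (subtree q t) (subtree p t).
Proof. by move=> qp s [/qp]. Qed.

Lemma tree_le_trans q p r : tree_le r q -> tree_le q p -> tree_le r p.
Proof. by move=> rq qp s /rq /qp. Qed.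

Lemma branchW q p f : tree_le q p -> branch q f -> branch p f.
Proof. by move=> qp qf n; apply/qp/qf. Qed.

Lemma branch_subtree q f m : branch q f -> branch (subtree q (mkseq f m)) f.
Proof.
move=> qf n; split; first exact: qf.
by case/orP: (leq_total n m) => /(prefix_mkseq f) ->; rewrite ?orbT.
Qed.

Lemma subtree_branch_agree q f f' m :
  branch (subtree q (mkseq f m)) f' -> agree_upto m f f'.
Proof.
move=> /(_ m) [_ h]; apply: mkseq_agree_upto.
by case/orP: h => /eq_prefix_size; rewrite !size_mkseq leqnn => /(_ isT) ->.
Qed.

Lemma subtree_mono q f m n :
  m <= n -> tree_le (subtree q (mkseq f n)) (subtree q (mkseq f m)).
Proof.
move=> mn s [qs h]; split=> //; case/orP: h => h; last first.
  by apply/orP; right; apply: prefix_trans h; apply: prefix_mkseq.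
have pm := prefix_mkseq f mn.
case: (leqP (size s) m) => sm; apply/orP; [left|right].
  by apply: prefix_comparable h pm _; rewrite size_mkseq.
by apply: prefix_comparable pm h _; rewrite size_mkseq ltnW.
Qed.

Lemma tree_prefix p s t : tree p -> prefix s t -> p t -> p s.
Proof.
move=> [_ pT]; case/prefixP => u ->; elim/last_ind: u => [|u b IH]; first by rewrite cats0.
by rewrite -rcons_cat => /pT.
Qed.

Lemma perfect_extend p s n :
  perfect_tree p -> p s -> size s <= n ->
  exists t, [/\ p t, size t = n & prefix s t].
Proof.
move=> [pT pP] ps /subnK <-.
elim: (n - size s) => [|k [t [pt tk st]]]; first by exists s; rewrite prefix_refl.
have [u [tu [pu _]]] := pP _ pt.
have tu' : prefix t (rcons u false) by apply: prefix_trans tu (prefix_rcons _ _).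
exists (take (size t).+1 (rcons u false)); split.
- exact: tree_prefix pT (prefix_take _ _) pu.
- by rewrite size_takel ?tk // -tk size_rcons ltnS size_prefix.
- apply: prefix_trans st _.
  by move: tu'; rewrite !prefixE take_takel.
Qed.

Lemma perfect_subtree p t : perfect_tree p -> p t -> perfect_tree (subtree p t).
Proof.
move=> pP pt; have [[p0 pT] pS] := pP; split.
  split=> [|s b [psb h]]; first by split; rewrite ?prefix0s.
  split; first exact: pT psb.
  case/orP: h => h; first by rewrite (prefix_trans (prefix_rcons s b) h).
  case: (leqP (size t) (size s)) => ts; apply/orP; [right|left].
    exact: prefix_comparable h (prefix_rcons _ _) ts.
  exact: prefix_comparable (prefix_rcons _ _) h (ltnW ts).
have key s : p s -> prefix t s -> exists u, [/\ prefix s u, subtree p t (rcons u false) & subtree p t (rcons u true)].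
  move=> ps ts; have [u [su [u0 u1]]] := pS _ ps.
  have tb b : prefix t (rcons u b).
    exact: prefix_trans ts (prefix_trans su (prefix_rcons _ _)).
  by exists u; split; rewrite /subtree ?tb ?orbT.
move=> s [ps /orP [st|ts]]; last by have [u []] := key _ ps ts; exists u.
have [u [tu u0 u1]] := key _ pt (prefix_refl _).
by exists u; split; [exact: prefix_trans st tu|].
Qed.

(** A perfect tree has a node at level [size t]; inside [subtree p t] that node is comparable with
    [t], hence equal to it. *)
Lemma perfect_level_mem p t r :
  perfect_tree r -> tree_le r (subtree p t) -> r t.
Proof.
move=> rP rp; have [u [ru ut _]] := perfect_extend rP rP.1.1 (leq0n (size t)).
have [_ /orP[h|h]] := rp _ ru; first by rewrite -(eq_prefix_size h) ?ut.
by rewrite (eq_prefix_size h) ?ut.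
Qed.

(** A level of the binary tree is finite, so upper bounds of pairs suffice; the induction peels off
    the first bit. Besides numbers, this is applied to strategies for I ordered pointwise. *)
Lemma finite_level_bound (T : Type) (le : T -> T -> Prop) (P : seq bool -> T -> Prop) (x0 : T) N :
  (forall x y, exists z, le x z /\ le y z) ->
  (forall s x y, P s x -> le x y -> P s y) ->
  (forall s, size s = N -> exists x, P s x) ->
  exists x, forall s, size s = N -> P s x.
Proof.
move=> dir mono; elim: N P mono => [|N IH] P mono ex.
  by have [x px] := ex [::] erefl; exists x => s /size0nil ->.
have step b : exists x, forall s, size s = N -> P (b :: s) x.
  apply: IH => [s x y|s sN]; first exact: mono.
  by apply: ex; rewrite /= sN.
have [x0' h0] := step false; have [x1 h1] := step true.
have [z [z0 z1]] := dir x0' x1.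
exists z => -[|[] s] //= [sN]; [apply: mono z1|apply: mono z0]; auto.
Qed.

Lemma finite_level_bound_nat (P : seq bool -> nat -> Prop) N :
  (forall s m n, P s m -> m <= n -> P s n) ->
  (forall s, size s = N -> exists n, P s n) ->
  exists n, forall s, size s = N -> P s n.
Proof.
apply: (@finite_level_bound _ leq P 0) => m n.
by exists (maxn m n); rewrite leq_maxl leq_maxr.
Qed.

(* One step from [(p, N)] to [(p', N')] of a fusion sequence: [p'] keeps the
   nodes of [p] up to level [N] and splits above each of them before [N']. *)
Definition fusion_ext (p : btree) (N : nat) (p' : btree) (N' : nat) : Prop :=
  [/\ tree_le p' p, forall s, size s <= N -> p s -> p' s, N < N' &
      forall s, size s <= N -> p' s -> exists t,
        [/\ prefix s t, size t < N', p' (rcons t false) & p' (rcons t true)]].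

(** The limit is the intersection. Nodes of [p k] up to level [N k] survive all later stages, and
    the successors of the splitting nodes found at stage [k.+1] have level at most [N k.+1], so they
    survive too. *)
Lemma fusion_limit (p : nat -> btree) (N : nat -> nat) :
  (forall k, perfect_tree (p k)) ->
  (forall k, fusion_ext (p k) (N k) (p k.+1) (N k.+1)) ->
  exists q, perfect_tree q /\ forall k, tree_le q (p k).
Proof.
move=> pP ext; pose q s := forall k, p k s.
have Nk k : k <= N k.
  by elim: k => // k IH; have [_ _ h _] := ext k; apply: leq_ltn_trans h.
have Nmono k j : N k <= N (k + j).
  elim: j => [|j IH]; rewrite ?addn0 // addnS.
  by have [_ _ h _] := ext (k + j); apply: leq_trans IH (ltnW h).
have dec k j : tree_le (p (k + j)) (p k).
  elim: j => [|j IH]; rewrite ?addn0 // addnS => s.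
  by have [h _ _ _] := ext (k + j) => /h /IH.
have stable k s : size s <= N k -> p k s -> q s.
  move=> sN ps i; case: (leqP i k) => [/subnKC ik|/ltnW /subnKC <-].
    by apply: (dec i (k - i)); rewrite ik.
  elim: (i - k) => [|j IH]; rewrite ?addn0 // addnS.
  have [_ h _ _] := ext (k + j).
  by apply: h => //; apply: leq_trans sN (Nmono _ _).
exists q; split; last by move=> k s; apply.
split; first split => [k|s b qs k]; [exact: (pP k).1.1|exact: (pP k).1.2 (qs k)|].
move=> s qs; have [_ _ _ sp] := ext (size s).
have [t [st tN t0 t1]] := sp s (Nk _) (qs _).
by exists t; split=> //; split; apply: stable (_.+1) _ _ _; rewrite ?size_rcons; eauto.
Qed.

Lemma perfect_split_bound p N : perfect_tree p ->
  exists N', N < N' /\ forall s, size s <= N -> p s -> exists t,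
    [/\ prefix s t, size t < N', p (rcons t false) & p (rcons t true)].
Proof.
move=> pP; pose P s n := p s -> exists t, [/\ prefix s t, size t < n, p (rcons t false) & p (rcons t true)].
have [|s sN|n hn] := @finite_level_bound_nat P N.
- by move=> s m n Pm mn /Pm [t [? tm ? ?]]; exists t; split=> //; apply: leq_trans mn.
- case: (EM (p s)) => ps; last by exists 0.
  by have [t [st [t0 t1]]] := pP.2 _ ps; exists (size t).+1 => _; exists t.
exists (maxn n N.+1); split; first by rewrite leq_maxr.
(* A node below level [N] is first extended to level [N], where the bound [n] applies. *)
move=> s sN ps; have [t [pt tN st]] := perfect_extend pP ps sN.
have [u [tu un u0 u1]] := hn _ tN pt.
exists u; split => //; [exact: prefix_trans st tu|by apply: leq_trans un _; rewrite leq_maxl].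
Qed.

(** Amalgamation: above each node of level [N] the tree is replaced by a subtree with property [R],
    and the union of the pieces is taken. *)
Lemma fusion_step p N (R : btree -> Prop) : perfect_tree p ->
  (forall t, p t -> size t = N ->
     exists r, [/\ perfect_tree r, tree_le r (subtree p t) & R r]) ->
  exists p' N', [/\ perfect_tree p', fusion_ext p N p' N' &
    forall t, p' t -> size t = N -> exists r, R r /\ tree_le (subtree p' t) r].
Proof.
move=> pP dense.
have /choice [rr hrr] : forall t, exists r, p t -> size t = N ->
    [/\ perfect_tree r, tree_le r (subtree p t) & R r].
  move=> t; case: (EM (p t /\ size t = N)) => [[pt tN]|nt]; last first.
    by exists p => pt tN; case: nt.
  by have [r hr] := dense t pt tN; exists r.
pose p' s := exists t, [/\ p t, size t = N & rr t s].
have p'p : tree_le p' p by move=> s [t [pt tN]]; have [_ h _] := hrr t pt tN; move/h => [].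
have rrt t : p t -> size t = N -> rr t t.
  by move=> pt tN; have [rP rle _] := hrr t pt tN; apply: perfect_level_mem rP rle.
have p'P : perfect_tree p'.
  split; first split.
  - have [t [pt tN _]] := perfect_extend pP pP.1.1 (leq0n N).
    by exists t; split=> //; have [[[]]] := hrr t pt tN.
  - move=> s b [t [pt tN h]]; exists t; split=> //.
    by have [[[_ rT] _ ] _ _] := hrr t pt tN; apply: rT h.
  - move=> s [t [pt tN h]]; have [[_ rS] _ _] := hrr t pt tN.
    by have [u [su [u0 u1]]] := rS _ h; exists u; split=> //; split; exists t.
have [N' [NN' sp]] := perfect_split_bound N p'P.
exists p', N'; split=> //.
  split=> // s sN ps; have [t [pt tN st]] := perfect_extend pP ps sN.
  exists t; split=> //; have [[rT _] _ _] := hrr t pt tN.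
  by apply: tree_prefix rT st _; apply: rrt.
(* Distinct nodes of one level are incomparable, so above [t] only the piece [rr t] contributes. *)
move=> t p't tN; have pt := p'p _ p't.
have [[rT _] rle Rr] := hrr t pt tN.
exists (rr t); split=> // s [[t' [pt' t'N rs]] h].
have small : prefix s t -> rr t s by move=> st; apply: tree_prefix rT st _; apply: rrt.
case/orP: h => // ts.
have [_ rle' _] := hrr t' pt' t'N.
have [_ /orP[st'|t's]] := rle' _ rs.
  by apply: small; rewrite (eq_prefix_size ts) ?prefix_refl // tN -t'N size_prefix.
have -> // : t = t'.
by apply: eq_prefix_size; rewrite ?tN ?t'N //; apply: prefix_comparable ts t's _; rewrite tN t'N.
Qed.

(** Stage [k] of a fusion treats the [k]-th index above all nodes of the current level; heredity
    carries the result to the limit tree. *)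
Lemma fusion_decide (I : countType) (p : btree) (R : I -> btree -> Prop) :
  perfect_tree p ->
  (forall i r r', R i r -> perfect_tree r' -> tree_le r' r -> R i r') ->
  (forall i r, perfect_tree r -> tree_le r p ->
     exists r', [/\ perfect_tree r', tree_le r' r & R i r']) ->
  exists q, [/\ perfect_tree q, tree_le q p &
    forall i, exists m, forall t, q t -> size t = m -> R i (subtree q t)].
Proof.
move=> pP her dense.
pose RN k r := if @choice.unpickle I k is Some i then R i r else True.
have herN k r r' : RN k r -> perfect_tree r' -> tree_le r' r -> RN k r'.
  by rewrite /RN; case: (choice.unpickle k) => // i; apply: her.
have step k (a : btree * nat) : exists b : btree * nat,
    perfect_tree a.1 -> tree_le a.1 p ->
    [/\ perfect_tree b.1, fusion_ext a.1 a.2 b.1 b.2 &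
        forall t, b.1 t -> size t = a.2 -> RN k (subtree b.1 t)].
  case: (EM (perfect_tree a.1 /\ tree_le a.1 p)) => [[aP ap]|na]; last first.
    by exists a => aP ap; case: na.
  have [|p' [N' [p'P ext h]]] := @fusion_step a.1 a.2 (RN k) aP.
    move=> t at_ tN; rewrite /RN; case: (choice.unpickle k) => [i|]; last first.
      by exists (subtree a.1 t); split=> //; apply: perfect_subtree.
    have [|r [rP rle Rr]] := dense i (subtree a.1 t) (perfect_subtree aP at_).
      by move=> s /subtreeW /ap.
    by exists r; split.
  exists (p', N') => _ _; split=> // t p't tN.
  have [r [Rr rle]] := h _ p't tN.
  by apply: herN Rr _ rle; apply: perfect_subtree.
have /choice [nx hnx] : forall ka : nat * (btree * nat), _ := fun ka => step ka.1 ka.2.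
pose st := fix st k := if k is j.+1 then nx (j, st j) else (p, 0).
have inv k : perfect_tree (st k).1 /\ tree_le (st k).1 p.
  elim: k => [|k [kP kp]]; first by split=> // s.
  have [P [le _ _ _] _] := hnx (k, st k) kP kp.
  by split=> //; apply: tree_le_trans kp.
have stepk := fun k => hnx (k, st k) (inv k).1 (inv k).2.
have [|q [qP qle]] := @fusion_limit (fun k => (st k).1) (fun k => (st k).2) (fun k => (inv k).1).
  by move=> k; have [] := stepk k.
exists q; split=> //; first exact: qle 0.
move=> i; exists (st (choice.pickle i)).2 => t qt tN.
have [_ _ /(_ t (qle (choice.pickle i).+1 t qt) tN)] := stepk (choice.pickle i).
rewrite /RN /= choice.pickleK => /her; apply; first exact: perfect_subtree.
exact/subtreeS/(qle (choice.pickle i).+1).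
Qed.

(** Clopenness of [D] relative to the branches of [q], with a uniform modulus. One implication is
    enough, since [f] and [f'] can be exchanged. *)
Definition decided_on (q : btree) (D : (nat -> bool) -> Prop) : Prop :=
  exists m, forall f f', branch q f -> branch q f' -> agree_upto m f f' ->
    D f -> D f'.

Lemma decided_onW q r D : tree_le r q -> decided_on q D -> decided_on r D.
Proof. by move=> rq [m h]; exists m => f f' /(branchW rq) ? /(branchW rq); apply: h. Qed.

Lemma agree_upto_sym T m (a b : nat -> T) : agree_upto m a b -> agree_upto m b a.
Proof. by move=> ab i im; rewrite ab. Qed.

Lemma decided_on_not q D : decided_on q D -> decided_on q (fun f => ~ D f).
Proof.
move=> [m h]; exists m => f f' qf qf' ff' nD Df'; apply: nD.
exact: h qf' qf (agree_upto_sym ff') Df'.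
Qed.

(** A hereditary [R] either holds on some perfect subtree or fails on all of them, and both
    alternatives are hereditary; so [fusion_decide] applies to their disjunction. *)
Lemma fusion_decide_or (I : countType) (p : btree) (R : I -> btree -> Prop) :
  perfect_tree p ->
  (forall i r r', R i r -> perfect_tree r' -> tree_le r' r -> R i r') ->
  exists q, [/\ perfect_tree q, tree_le q p &
    forall i, exists m, forall t, q t -> size t = m ->
      R i (subtree q t) \/
      forall r, perfect_tree r -> tree_le r (subtree q t) -> ~ R i r].
Proof.
move=> pP her; apply: (@fusion_decide I p (fun i r => R i r \/
  forall r', perfect_tree r' -> tree_le r' r -> ~ R i r')) => //.
- move=> i r r' [h|h] r'P le; [left; exact: her le|right=> r'' ? le'].
  by apply: h => //; apply: tree_le_trans le.
- move=> i r rP _.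
  case: (EM (exists r', [/\ perfect_tree r', tree_le r' r & R i r'])) => [[r' [? ? h]]|h].
    by exists r'; split=> //; left.
  by exists r; split=> //; right=> r' r'P le Rr; apply: h; exists r'.
Qed.

Definition forces (q : btree) (R : btree -> Prop) (f : nat -> bool) : Prop :=
  exists m, R (subtree q (mkseq f m)).

Lemma fusion_forces (I : countType) (p : btree) (R : I -> btree -> Prop) :
  perfect_tree p ->
  (forall i r r', R i r -> perfect_tree r' -> tree_le r' r -> R i r') ->
  exists q, [/\ perfect_tree q, tree_le q p,
    forall i, decided_on q (forces q (R i)) &
    forall i, exists m, forall f, branch q f ->
      (forces q (R i) f -> R i (subtree q (mkseq f m))) /\
      (~ forces q (R i) f -> forall r, perfect_tree r ->
         tree_le r (subtree q (mkseq f m)) -> ~ R i r)].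
Proof.
move=> pP her; have [q [qP qp dec]] := fusion_decide_or pP her.
have key i : exists m, forall f, branch q f ->
      (forces q (R i) f -> R i (subtree q (mkseq f m))) /\
      (~ forces q (R i) f -> forall r, perfect_tree r ->
         tree_le r (subtree q (mkseq f m)) -> ~ R i r).
  have [m hm] := dec i; exists m => f qf.
  have [h|h] := hm (mkseq f m) (qf m) (size_mkseq _ _).
    by split=> // -[]; exists m.
  (* If [R i] fails hereditarily at level [m] but holds at level [m'], the subtree at the larger
     level gives a contradiction. *)
  split=> // -[m' h']; case: (h (subtree q (mkseq f (maxn m m')))).
  - exact: perfect_subtree.
  - by apply: subtree_mono; rewrite leq_maxl.
  - apply: her h' _ _; first exact: perfect_subtree.
    by apply: subtree_mono; rewrite leq_maxr.
exists q; split=> // i; have [m hm] := key i.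
exists m => f f' qf qf' ff' /(proj1 (hm f qf)) h.
by exists m; rewrite -(agree_upto_mkseq ff').
Qed.

(** * Spans, almost inclusion and diagonalization *)

Section Spans.
Variable F : countFieldType.
Implicit Types (X Y Z : nat -> vec F) (u v : vec F) (w : seq (vec F)).

(** The restriction to nonzero coefficients is what lets [blestar_tle] ignore the blocks before the
    tail. *)
Lemma inspan_comb X Y v n (c : nat -> F) :
  (forall i, i < n -> c i != 0%R -> inspan X (Y i)) ->
  (forall j, v j = \sum_(i < n) c i * Y i j)%R -> inspan X v.
Proof.
move=> XY vE.
have /choice [m /choice [d hd]] : forall i, exists m, exists d : nat -> F,
    i < n -> c i != 0%R -> forall j, (Y i j = \sum_(k < m) d k * X k j)%R.
  move=> i; case: (EM (i < n /\ c i != 0%R)) => [[ni ci]|ni]; last first.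
    by exists 0, (fun=> 0%R) => ? ?; case: ni.
  by have [m [d hd]] := XY i ni ci; exists m, d.
pose M := (\max_(i < n) m i)%N.
exists M, (fun k => \sum_(i < n) c i * (if (k < m i)%N then d i k else 0))%R => j.
rewrite vE; under [RHS]eq_bigr => k _ do rewrite GRing.mulr_suml.
rewrite exchange_big /=; apply: eq_bigr => i _.
have [->|ci] := eqVneq (c i) 0%R.
  by rewrite GRing.mul0r big1 // => k _; rewrite !GRing.mul0r.
rewrite (hd i (ltn_ord i) ci) GRing.mulr_sumr.
have mM : m i <= M by apply: (leq_bigmax i).
rewrite (big_ord_widen M (fun k => c i * (d i k * X k j))%R mM) big_mkcond /=.
by apply: eq_bigr => k _; case: ifP => _; rewrite ?GRing.mulrA // GRing.mulr0 GRing.mul0r.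
Qed.

Lemma inspan_gen X n : inspan X (X n).
Proof.
exists n.+1, (fun i => (i == n)%:R%R) => j.
rewrite big_ord_recr /= eqxx GRing.mul1r big1 ?GRing.add0r // => i _.
by rewrite ltn_eqF ?GRing.mul0r.
Qed.

Lemma ble_gen X Y : (forall n, inspan X (Y n)) -> ble Y X.
Proof. by move=> XY v [n [c vE]]; apply: inspan_comb vE => i _ _. Qed.

Lemma ble_trans X Y Z : ble Z Y -> ble Y X -> ble Z X.
Proof. by move=> ZY YX v /ZY /YX. Qed.

Definition tail m X : nat -> vec F := fun n => X (n + m).

Lemma ble_tail m X : ble (tail m X) X.
Proof. by apply: ble_gen => n; apply: inspan_gen. Qed.

Lemma blockseq_tail m X : blockseq X -> blockseq (tail m X).
Proof. by move=> [X0 X1]; split=> n; rewrite /tail ?addSn. Qed.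

Lemma blockseq_vlt X i j : blockseq X -> i < j -> vlt (X i) (X j).
Proof.
move=> [X0 X1] /subnKC <-; elim: (j - i.+1) => [|k IH]; rewrite ?addn0 // addnS.
move=> a b ha hb; have [c hc] := X0 (i.+1 + k).
exact: ltn_trans (IH _ _ ha hc) (X1 _ _ _ hc hb).
Qed.

Lemma blockseq_supp X k j : blockseq X -> X k j != 0%R -> k <= j.
Proof.
move=> Xb; elim: k j => // k IH j hj; have [i hi] := Xb.1 k.
exact: leq_ltn_trans (IH _ hi) (Xb.2 _ _ _ hi hj).
Qed.

Lemma above_tail n X k : blockseq X -> n < k -> forall i, above n (tail k X i).
Proof.
move=> Xb nk i j /(blockseq_supp Xb); apply: leq_trans.
exact: leq_trans nk (leq_addl _ _).
Qed.

Lemma aboveW m n v : m <= n -> above n v -> above m v.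
Proof. by move=> mn vn j /vn; apply: leq_ltn_trans. Qed.

(* [tle Y X] is the working form of [Y <=* X]: for block sequences the two are
   equivalent, but [tle] can be used on vectors without knowing their
   coefficients. *)
Definition tle Y X : Prop :=
  exists n, forall v, inspan Y v -> above n v -> inspan X v.

Lemma tle_ble Y X : ble Y X -> tle Y X.
Proof. by move=> YX; exists 0 => v /YX. Qed.

Lemma tle_trans X Y Z : tle Z Y -> tle Y X -> tle Z X.
Proof.
move=> [m hm] [n hn]; exists (maxn m n) => v Zv av.
apply: hn; first apply: hm => //.
- by apply: aboveW av; rewrite leq_maxl.
- by apply: aboveW av; rewrite leq_maxr.
Qed.

Lemma tle_tail Y X : blockseq Y -> tle Y X -> exists m, ble (tail m Y) X.
Proof.
move=> Yb [n hn]; exists n.+1; apply: ble_gen => i.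
by apply: hn; [exact: inspan_gen|exact: above_tail].
Qed.

(** Take [n] in the support of [Y m]. Blocks have disjoint supports, so a block before the [m]-th
    with nonzero coefficient in [v] would give [v] a support point below [n]. *)
Lemma blestar_tle Y X : blockseq Y -> blestar Y X -> tle Y X.
Proof.
move=> Yb [m YX]; have [n hn] := Yb.1 m.
exists n => v [N [c vE]] av; apply: (inspan_comb _ vE) => i iN ci.
case: (leqP m i) => [mi|im].
  by apply: YX; rewrite -(subnK mi); exact: (inspan_gen (tail m Y)).
have [j hj] := Yb.1 i.
have jn : j < n := blockseq_vlt Yb im hj hn.
suff vj : v j != 0%R by have := av _ vj; rewrite ltnNge ltnW.
rewrite vE (bigD1 (Ordinal iN)) //= big1 ?GRing.addr0 ?GRing.mulf_neq0 //.
move=> k; rewrite -val_eqE /= => ki.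
suff -> : Y k j = 0%R by rewrite GRing.mulr0.
apply/eqP; apply: contraTT isT => hk.
case: (ltngtP k i) ki => // h _.
- by have := blockseq_vlt Yb h hk hj; rewrite ltnn.
- by have := blockseq_vlt Yb h hj hk; rewrite ltnn.
Qed.

Definition legal_next w v : Prop := nonzero v /\ forall x, x \in w -> vlt x v.

Lemma vec_supp_bound v : exists b, forall j, v j != 0%R -> j <= b.
Proof.
exists (\max_(j <- finsupp v) j)%N => j; rewrite -mem_finsupp => jv.
exact: (@leq_bigmax_seq _ _ (fun=> true) (fun i => i)).
Qed.

Lemma above_vlt w : exists n, forall v, above n v -> forall x, x \in w -> vlt x v.
Proof.
elim: w => [|a w [n IH]]; first by exists 0.
have [b hb] := vec_supp_bound a; exists (maxn n b) => v av x.
rewrite inE => /orP [/eqP ->|xw].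
  by move=> i j /hb ib /(aboveW (leq_maxr n b) av); apply: leq_ltn_trans.
by apply: IH xw; apply: aboveW av; rewrite leq_maxl.
Qed.

Lemma legal_next_exists X w n : blockseq X ->
  exists z, [/\ inspan X z, legal_next w z & above n z].
Proof.
move=> Xb; have [m hm] := above_vlt w.
have ab : above (maxn m n) (tail (maxn m n).+1 X 0) by apply: above_tail.
exists (tail (maxn m n).+1 X 0); split; first exact: inspan_gen.
- split; first exact: Xb.1.
  by apply: hm; apply: aboveW ab; rewrite leq_maxl.
- by apply: aboveW ab; rewrite leq_maxr.
Qed.

Lemma inspan_concat_rcons w z Z Z' v : inspan Z z -> ble Z' Z ->
  inspan (concat_seq (rcons w z) Z') v -> inspan (concat_seq w Z) v.
Proof.
have ZC : ble Z (concat_seq w Z).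
  apply: ble_gen => n; have := inspan_gen (concat_seq w Z) (n + size w).
  by rewrite /concat_seq ltnNge leq_addl addnK.
move=> Zz Z'Z; apply: ble_gen => n; rewrite {2}/concat_seq nth_rcons size_rcons ltnS.
case: ltngtP => nw.
- by have := inspan_gen (concat_seq w Z) n; rewrite /concat_seq nw.
- by apply/ZC/Z'Z/inspan_gen.
- exact: ZC.
Qed.

Lemma inspan_concat_mkseq Z v : inspan Z v ->
  exists n, forall Z', inspan (concat_seq (mkseq Z n) Z') v.
Proof.
move=> [n [c vE]]; exists n => Z'; exists n, c => j; rewrite vE.
by apply: eq_bigr => i _; rewrite /concat_seq size_mkseq ltn_ord nth_mkseq.
Qed.

Lemma ble_concat_nil Z : ble (concat_seq [::] Z) Z.
Proof. by apply: ble_gen => n; rewrite /concat_seq /= subn0; apply: inspan_gen. Qed.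

Definition star_closed (P : (nat -> vec F) -> Prop) : Prop :=
  forall Y Z, P Y -> tle Z Y -> P Z.

Section Filter.
Variable U : bset F.
Hypotheses (filterU : Defs.filter U) (pU : property_p U).

Lemma filter_blockseq X : U X -> blockseq X.
Proof. by move: X; case: filterU.1 => _ []. Qed.

(** A decreasing sequence in [U] passes below a chosen witness of each satisfiable [P i]; $(p)$
    gives a member of [U] almost below all terms, and star-closure transfers every [P i] to it. *)
Lemma diagonal_lower_bound (I : countType) (P : I -> (nat -> vec F) -> Prop) X :
  U X -> (forall i, star_closed (P i)) ->
  exists Y, restr U X Y /\ forall i, (exists2 Y', U Y' & P i Y') -> P i Y.
Proof.
move=> UX clP.
have /choice [Ys hYs] : forall i, exists Y, U Y /\ ((exists2 Y', U Y' & P i Y') -> P i Y).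
  move=> i; case: (EM (exists2 Y', U Y' & P i Y')) => [[Y UY PY]|nY].
    by exists Y.
  by exists X; split=> // /nY.
pose Yn n := if @choice.unpickle I n is Some i then Ys i else X.
have UYn n : U (Yn n) by rewrite /Yn; case: (choice.unpickle n) => // i; case: (hYs i).
have /choice [nx hnx] : forall nZ : nat * (nat -> vec F), exists Z,
    U nZ.2 -> [/\ U Z, ble Z nZ.2 & ble Z (Yn nZ.1)].
  move=> [n Z] /=; case: (EM (U Z)) => UZ; last by exists Z.
  by have [Z' [UZ' [h1 h2]]] := filterU.2 _ _ UZ (UYn n); exists Z'.
pose Zs := fix Zs n := if n is k.+1 then nx (k, Zs k) else X.
have UZ n : U (Zs n) by elim: n => //= n IH; have [] := hnx (n, Zs n) IH.
have [|W [UW hW]] := pU UZ.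
  by move=> n; have [] := hnx (n, Zs n) (UZ n).
have [Y [UY [YW YX]]] := filterU.2 _ _ UW UX.
exists Y; split=> // i /(proj2 (hYs i)) Pi.
apply: clP Pi _; apply: tle_trans (tle_ble YW) _.
apply: tle_trans (blestar_tle (filter_blockseq UW) (hW (choice.pickle i).+1)) _.
apply: tle_ble; have [_ _] := hnx (choice.pickle i, Zs (choice.pickle i)) (UZ _).
by rewrite /Yn choice.pickleK.
Qed.

End Filter.
End Spans.

(** * Parametrized fullness *)

Section Strategies.
Variable F : countFieldType.
Local Notation bseq := (nat -> vec F).

Definition almost (Y : bseq) (Q : vec F -> Prop) : Prop :=
  exists n, forall z, inspan Y z -> above n z -> Q z.

Lemma almost_star_closed (Q : vec F -> Prop) : star_closed (almost^~ Q).
Proof.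
move=> Y Z [m hm] [n hn]; exists (maxn m n) => z Zz az.
apply: hm; first apply: hn => //.
- by apply: aboveW az; rewrite leq_maxr.
- by apply: aboveW az; rewrite leq_maxl.
Qed.

Lemma mkseq_concat (xs : seq (vec F)) (ys : bseq) k :
  mkseq (concat_seq xs ys) (size xs + k) = xs ++ mkseq ys k.
Proof.
apply: (@eq_from_nth _ (vzero F)); rewrite size_mkseq ?size_cat ?size_mkseq // => i ik.
rewrite nth_mkseq // nth_cat /concat_seq; case: ltnP => // xi.
by rewrite nth_mkseq //; lia.
Qed.

(** II keeps a state in memory, from which [w] reads off the position; an outcome then returns the
    whole run of states behind it. *)
Lemma stratII_build (S : Type) (s0 : S) (w : S -> seq (vec F))
    (step : S -> S -> Prop) (Inv : S -> Prop) (X : bseq) :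
  Inv s0 ->
  (forall s Y, Inv s -> blockseq Y -> ble Y X -> exists z s',
     [/\ inspan Y z, legal_next (w s) z, w s' = rcons (w s) z, Inv s' & step s s']) ->
  exists alpha, is_stratII_G (w s0) X alpha /\
    forall Z, outcomeII_G (w s0) X alpha Z -> exists st : nat -> S,
      st 0 = s0 /\ forall k, [/\ Inv (st k),
        w (st k) = mkseq Z (size (w s0) + k) & step (st k) (st k.+1)].
Proof.
move=> I0 ex.
have /choice [nx hnx] : forall sY : S * bseq, exists zs : vec F * S,
    Inv sY.1 -> blockseq sY.2 -> ble sY.2 X ->
    [/\ inspan sY.2 zs.1, legal_next (w sY.1) zs.1, w zs.2 = rcons (w sY.1) zs.1,
        Inv zs.2 & step sY.1 zs.2].
  move=> [s Y] /=; case: (EM [/\ Inv s, blockseq Y & ble Y X]) => [[h1 h2 h3]|nh].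
    by have [z [s' h]] := ex s Y h1 h2 h3; exists (z, s').
  by exists (vzero F, s) => h1 h2 h3; case: nh.
pose run := foldl (fun s Y => (nx (s, Y)).2) s0.
(* A strategy sees only I's moves: the state is recomputed from all moves but the last, which is
   then answered. *)
pose alpha (h : seq bseq) :=
  (nx (run (take (size h).-1 h), nth (fun=> vzero F) h (size h).-1)).1.
have alphaE Ys k : respII alpha Ys k = (nx (run (mkseq Ys k), Ys k)).1.
  by rewrite /respII /alpha size_mkseq /= take_mkseq // nth_mkseq.
have runS Ys k : run (mkseq Ys k.+1) = (nx (run (mkseq Ys k), Ys k)).2.
  by rewrite mkseqS /run foldl_rcons.
have inv Ys k : legalI_G X Ys -> Inv (run (mkseq Ys k)).
  move=> lY; elim: k => // k IH; rewrite runS.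
  by have [] := hnx (run (mkseq Ys k), Ys k) IH (lY k).1 (lY k).2.
have stepk Ys k (lY : legalI_G X Ys) :=
  hnx (run (mkseq Ys k), Ys k) (inv Ys k lY) (lY k).1 (lY k).2.
have wE Ys k : legalI_G X Ys -> w (run (mkseq Ys k)) = w s0 ++ mkseq (respII alpha Ys) k.
  move=> lY; elim: k => [|k IH]; first by rewrite cats0.
  rewrite runS mkseqS -rcons_cat -IH alphaE.
  by have [] := stepk Ys k lY.
exists alpha; split.
  move=> Ys lY k; have [h1 [h2 h3] _ _ _] := stepk Ys k lY.
  rewrite -alphaE wE // in h1 h2 h3; split=> //; split=> //; split=> [x xs|i ik].
    by apply: h3; rewrite mem_cat xs.
  by apply: h3; rewrite mem_cat; apply/orP; right; apply: map_f; rewrite mem_iota.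
move=> Z [Ys [lY ZE]]; exists (fun k => run (mkseq Ys k)); split=> // k; split.
- exact: inv.
- by rewrite wE // -mkseq_concat; apply/esym/eq_mkseq.
- by rewrite runS; have [] := stepk Ys k lY.
Qed.

End Strategies.

Section ParametrizedFullness.
Variables (F : countFieldType) (U : bset F).
Hypotheses (stratU : strategic U) (pplusU : pplus_filter U).
Local Notation bseq := (nat -> vec F).

Let filterU : Defs.filter U := pplusU.1.
Let fullU : full U := pplusU.2.1.
Let pU : property_p U := pplusU.2.2.
Let exU : exists X, U X := filterU.1.1.

Section Acceptance.
Variable D : (nat -> bool) -> vec F -> Prop.

(** Letting [Z] range over all of [tle Z Y] makes rejection star-closed, so that it can be
    diagonalized. *)
Definition rejects (w : seq (vec F)) (r : btree) (Y : bseq) : Prop :=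
  forall f, branch r f -> forall Z, blockseq Z -> tle Z Y ->
    ~ (forall v, inspan (concat_seq w Z) v -> D f v).

Definition rejected w r : Prop := exists2 Y, U Y & rejects w r Y.

Definition accepted w r : Prop :=
  forall r', perfect_tree r' -> tree_le r' r -> ~ rejected w r'.

Lemma rejectsW w r r' Y : rejects w r Y -> tree_le r' r -> rejects w r' Y.
Proof. by move=> h le f /(branchW le); apply: h. Qed.

Lemma rejectedW w r r' : rejected w r -> tree_le r' r -> rejected w r'.
Proof. by move=> [Y UY h] le; exists Y => //; apply: rejectsW h le. Qed.

Lemma rejects_star_closed w r : star_closed (rejects w r).
Proof. by move=> Y Z h ZY f rf Z' bZ' Z'Z; apply: h => //; apply: tle_trans ZY. Qed.

Lemma acceptedW w r r' : accepted w r -> tree_le r' r -> accepted w r'.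
Proof. by move=> h le r'' P le'; apply: h => //; apply: tree_le_trans le. Qed.

Lemma decide_acceptance q : perfect_tree q -> exists q1 Y1,
  [/\ perfect_tree q1, tree_le q1 q, U Y1 &
      forall w, exists m, forall t, q1 t -> size t = m ->
        rejects w (subtree q1 t) Y1 \/ accepted w (subtree q1 t)].
Proof.
move=> qP; have [|q1 [q1P q1q dec]] := @fusion_decide_or (seq (vec F)) q rejected qP.
  by move=> w r r' h _; apply: rejectedW.
have [X UX] := exU.
have [|Y1 [[UY1 _] h]] := @diagonal_lower_bound F U filterU pU (seq (vec F) * seq bool)%type
   (fun wt => rejects wt.1 (subtree q1 wt.2)) X UX.
  by move=> wt; apply: rejects_star_closed.
exists q1, Y1; split=> // w; have [m hm] := dec w; exists m => t qt tm.
by case: (hm t qt tm) => [rej|]; [left; apply: (h (w, t))|right].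
Qed.

Section Decided.
Variables (q1 : btree) (Y1 : bseq).
Hypotheses (q1P : perfect_tree q1) (UY1 : U Y1).
Hypothesis dec : forall w, exists m, forall t, q1 t -> size t = m ->
  rejects w (subtree q1 t) Y1 \/ accepted w (subtree q1 t).

(** As [w] is not rejected, some branch [f] and some [Z] put the span of [w, Z] inside [D f]. For
    [z] in the span of [Z], the span of [w, z] and a tail of [Z] stays inside [D f], so [Y1] cannot
    reject [rcons w z] near [f]; by [dec] it is accepted there. *)
Lemma accepted_extend r w Y :
  perfect_tree r -> tree_le r q1 -> accepted w r -> U Y ->
  exists Z, [/\ blockseq Z, ble Z Y & forall z, inspan Z z -> legal_next w z ->
    exists r', [/\ perfect_tree r', tree_le r' r & accepted (rcons w z) r']].
Proof.
move=> rP rq1 acc UY; have [Y' [UY' [Y'Y Y'Y1]]] := filterU.2 _ _ UY UY1.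
have : ~ rejects w r Y' by move=> rej; apply: (acc r rP) => //; exists Y'.
move=> /existsNP [f /not_implyP [rf /existsNP [Z /not_implyP [bZ]]]].
move=> /not_implyP [ZY' /contrapT DZ].
have [k kY'] := tle_tail bZ ZY'.
exists (tail k Z); split; [exact: blockseq_tail|exact: ble_trans kY' Y'Y|].
move=> z Zz _; have [m hm] := dec (rcons w z).
have q1f := branchW rq1 rf.
have [rej|acc'] := hm (mkseq f m) (q1f m) (size_mkseq _ _).
  case: (rej f (branch_subtree m q1f) (tail k Z) (blockseq_tail _ bZ)).
    exact/tle_ble/(ble_trans kY').
  move=> v vs; apply: DZ; apply: inspan_concat_rcons vs.
    exact: ble_tail Zz.
  exact: ble_tail.
exists (subtree r (mkseq f m)); split.
- exact: perfect_subtree.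
- exact: subtreeW.
- exact/(acceptedW acc')/subtreeS.
Qed.

(** The sequence given by [accepted_extend] need not lie in [U]; fullness, applied to the set [D']
    of suitable next vectors, yields one that does. *)
Lemma accepted_extend_filter r w :
  perfect_tree r -> tree_le r q1 -> accepted w r ->
  exists2 Y, U Y & forall z, inspan Y z -> legal_next w z ->
    exists r', [/\ perfect_tree r', tree_le r' r & accepted (rcons w z) r'].
Proof.
move=> rP rq1 acc.
pose D' z := legal_next w z -> exists r', [/\ perfect_tree r', tree_le r' r & accepted (rcons w z) r'].
have [|Z [[UZ _] hZ]] := fullU (D := D') UY1; last by exists Z.
move=> Y [UY _]; have [Z [bZ ZY hZ]] := accepted_extend rP rq1 acc UY.
by exists Z.
Qed.

Definition step_ok (w : seq (vec F)) (r : btree) (N : nat) (z : vec F) (r' : btree) (N' : nat) : Prop :=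
  [/\ perfect_tree r', fusion_ext r N r' N' & accepted (rcons w z) r'].

(** The extension is made above all nodes of level [N] at once: one [Y] serves all nodes by
    diagonalization, one bound [n] by finiteness of the level, and [fusion_step] glues the trees. *)
Lemma accepted_step w r N :
  perfect_tree r -> tree_le r q1 -> accepted w r ->
  exists2 Y, U Y & almost Y (fun z => legal_next w z -> exists r' N', step_ok w r N z r' N').
Proof.
move=> rP rq1 acc.
pose Q t z := legal_next w z ->
  exists r', [/\ perfect_tree r', tree_le r' (subtree r t) & accepted (rcons w z) r'].
have [|Y [[UY _] hY]] := @diagonal_lower_bound F U filterU pU (seq bool) (fun t Y => almost Y (Q t)) Y1 UY1.
  by move=> t; apply: almost_star_closed.
exists Y => //.
have [|t tN|n hn] := @finite_level_bound_nat
    (fun t n => r t -> forall z, inspan Y z -> above n z -> Q t z) N.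
- by move=> t m n h mn rt z Yz az; apply: h => //; apply: aboveW az.
- case: (EM (r t)) => rt; last by exists 0.
  have [] : almost Y (Q t); last by move=> n h; exists n => _.
  apply: hY; have [||Z UZ hZ] := @accepted_extend_filter (subtree r t) w (perfect_subtree rP rt).
  + exact: tree_le_trans (@subtreeW _ _) rq1.
  + exact: acceptedW acc (@subtreeW _ _).
  by exists Z => //; exists 0 => z Zz _; apply: hZ.
exists n => z Yz az nz.
have [|r' [N' [r'P ext h]]] := @fusion_step r N (accepted (rcons w z)) rP.
  by move=> t rt tN; apply: hn.
exists r', N'; split=> // r'' r''P le rej.
(* A rejecting subtree would pass through a node of level [N], above which it lies inside an
   accepting tree. *)
have [t [rt tN _]] := perfect_extend r''P r''P.1.1 (leq0n N).
have [s [accs les]] := h t (le _ rt) tN.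
apply: (accs (subtree r'' t)).
- exact: perfect_subtree.
- exact: tree_le_trans (subtreeS le) les.
- exact: rejectedW rej (@subtreeW _ _).
Qed.

Lemma accepted_fusion :
  accepted [::] q1 -> (forall v, decided_on q1 (D^~ v)) ->
  exists q2 Y2, [/\ perfect_tree q2, tree_le q2 q1, U Y2 &
    forall f, branch q2 f -> forall v, inspan Y2 v -> D f v].
Proof.
move=> acc0 Dcont.
have /choice [nx hnx] : forall a : (btree * nat) * seq (vec F) * vec F, exists b : btree * nat,
    (exists r' N', step_ok a.1.2 a.1.1.1 a.1.1.2 a.2 r' N') ->
    step_ok a.1.2 a.1.1.1 a.1.1.2 a.2 b.1 b.2.
  move=> a; case: (EM (exists r' N', step_ok a.1.2 a.1.1.1 a.1.1.2 a.2 r' N')).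
    by move=> [r' [N' h]]; exists (r', N').
  by move=> nh; exists a.1.1.
(* The fusion stage is made a function of the position, so that the countably many requirements
   [Q w] can be diagonalized by one [Y2] before the game starts. *)
pose stw := foldl (fun (b : seq (vec F) * (btree * nat)) z =>
  (rcons b.1 z, nx (b.2, b.1, z))) ([::], (q1, 0)).
pose st w := (stw w).2.
have stw1 w : (stw w).1 = w.
  by elim/last_ind: w => // w z IH; rewrite /stw foldl_rcons /= -/stw IH.
have st_rcons w z : st (rcons w z) = nx (st w, w, z).
  by rewrite /st /stw foldl_rcons /= -/stw stw1.
pose good w := [/\ perfect_tree (st w).1, tree_le (st w).1 q1 & accepted w (st w).1].
pose Q w z := legal_next w z -> good (rcons w z) /\
  fusion_ext (st w).1 (st w).2 (st (rcons w z)).1 (st (rcons w z)).2.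
have [|Y2 [[UY2 _] hY2]] := @diagonal_lower_bound F U filterU pU (seq (vec F))
    (fun w Y => almost Y (Q w)) Y1 UY1.
  by move=> w; apply: almost_star_closed.
have goodQ w : good w -> almost Y2 (Q w).
  move=> [wP wq1 accw]; apply: hY2.
  have [Y UY [n hn]] := @accepted_step w _ (st w).2 wP wq1 accw.
  exists Y => //; exists n => z Yz az /(hn z Yz az) /(hnx (st w, w, z)) /=.
  rewrite -st_rcons => -[P ext acc]; split=> //; split=> //.
  by case: ext => h _ _ _; apply: tree_le_trans wq1.
have good0 : good [::] by split=> //; rewrite /tree_le.
have [|w Y gw bY YY2|alpha [stalpha out]] := @stratII_build F (seq (vec F)) [::] id
  (fun w w' => fusion_ext (st w).1 (st w).2 (st w').1 (st w').2) good Y2.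
- exact: good0.
- have [n hn] := goodQ w gw; have [z [Yz nz az]] := legal_next_exists w n bY.
  have [g e] := hn z (YY2 _ Yz) az nz.
  by exists z, (rcons w z).
have [Z [oZ UZ]] := stratU UY2 stalpha.
have [s [_ hs]] := out Z oZ.
have sE k : s k = mkseq Z k by have [_ ->] := hs k.
have gk k : good (mkseq Z k) by rewrite -sE; have [] := hs k.
have [||q2 [q2P le]] := @fusion_limit (fun k => (st (s k)).1) (fun k => (st (s k)).2).
- by move=> k; have [[]] := hs k.
- by move=> k; have [] := hs k.
exists q2, Z; split=> //.
  by move=> t /(le 0); rewrite sE; have [_ h _] := gk 0; apply: h.
(* If [D f v] failed, it would fail for all branches near [f]. As [v] is in the span of a finite
   initial segment of [Z], that segment would be rejected near [f], although it is accepted. *)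
move=> f q2f v Zv; apply: contrapT => nD.
have [n hn] := inspan_concat_mkseq Zv.
have [rP rq1 acc] := gk n.
have rf : branch (st (mkseq Z n)).1 f by rewrite -sE; apply: branchW (le n) q2f.
have [m hm] := Dcont v.
apply: (acc (subtree (st (mkseq Z n)).1 (mkseq f m))).
- exact: perfect_subtree.
- exact: subtreeW.
exists Y1 => // f' rf' Z' _ _ /(_ v (hn Z')) Df'; apply: nD.
apply: hm Df'; last 2 first.
- exact: branchW rq1 rf.
- by move=> i im; rewrite (subtree_branch_agree rf').
- exact: branchW rq1 (branchW (@subtreeW _ _) rf').
Qed.

End Decided.

Lemma parametrized_fullness q :
  perfect_tree q -> (forall v, decided_on q (D^~ v)) ->
  exists r Y, [/\ perfect_tree r, tree_le r q, U Y &
    (forall f, branch r f -> forall v, inspan Y v -> D f v) \/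
    (forall f, branch r f -> forall Z, blockseq Z -> tle Z Y ->
       exists2 v, inspan Z v & ~ D f v)].
Proof.
move=> qP Dcont; case: (EM (accepted [::] q)) => [acc|].
  have [q1 [Y1 [q1P q1q UY1 dec]]] := decide_acceptance qP.
  have [||q2 [Y2 [q2P q2q1 UY2 h]]] := accepted_fusion q1P UY1 dec.
  - exact: acceptedW q1q.
  - by move=> v; apply: decided_onW q1q _.
  by exists q2, Y2; split=> //; [exact: tree_le_trans q1q|left].
move=> /existsNP [r /not_implyP [rP /not_implyP [rq /contrapT [Y UY rej]]]].
exists r, Y; split=> //; right=> f rf Z bZ ZY.
apply: contrapT => h; apply: (rej f rf Z bZ ZY) => v /ble_concat_nil Zv.
by apply: contrapT => nD; apply: h; exists v.
Qed.

End Acceptance.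
End ParametrizedFullness.

(** * Open games *)

Section OpenGames.
Variable F : countFieldType.
Local Notation bseq := (nat -> vec F).

(* A strategy for II in an open game is a well-founded tree, so that II's
   goal is reached after finitely many moves along every play. *)
Inductive wtree : Type :=
  | Done
  | Play of (bseq -> vec F) & (bseq -> wtree).

(** I's moves range over [tle Z Y] rather than [ble Z Y], which makes winning star-closed. *)
Fixpoint wins (O : seq (vec F) -> Prop) (Y : bseq) (w : seq (vec F)) (tau : wtree) : Prop :=
  match tau with
  | Done => O w
  | Play h c => forall Z, blockseq Z -> tle Z Y ->
      [/\ inspan Z (h Z), legal_next w (h Z) & wins O Y (rcons w (h Z)) (c Z)]
  end.

Lemma wins_star_closed O w tau : star_closed (fun Y => wins O Y w tau).
Proof.
elim: tau w => [|h c IH] w Y Y' //= win Y'Y Z bZ ZY'.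
have [h1 h2 h3] := win Z bZ (tle_trans ZY' Y'Y).
by split=> //; apply: IH h3 Y'Y.
Qed.

Lemma wins_intro O Y w :
  (forall Z, blockseq Z -> tle Z Y ->
     exists z tau, [/\ inspan Z z, legal_next w z & wins O Y (rcons w z) tau]) ->
  exists tau, wins O Y w tau.
Proof.
move=> ex.
have /choice [s hs] : forall Z, exists zt : vec F * wtree, blockseq Z -> tle Z Y ->
    [/\ inspan Z zt.1, legal_next w zt.1 & wins O Y (rcons w zt.1) zt.2].
  move=> Z; case: (EM (blockseq Z /\ tle Z Y)) => [[bZ ZY]|nZ]; last first.
    by exists (vzero F, Done) => bZ ZY; case: nZ.
  by have [z [tau h]] := ex Z bZ ZY; exists (z, tau).
by exists (Play (fun Z => (s Z).1) (fun Z => (s Z).2)) => Z /= bZ ZY; apply: hs.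
Qed.

(* [Z] is an outcome of [F[x, Y]] in which I follows [sigma], here a function
   of the whole position (including [x]). *)
Definition play_F (x : seq (vec F)) (Y : bseq) (sigma : seq (vec F) -> nat) (Z : bseq) : Prop :=
  mkseq Z (size x) = x /\ forall k, size x <= k ->
    [/\ legal_next (mkseq Z k) (Z k), inspan Y (Z k) & above (sigma (mkseq Z k)) (Z k)].

Variable U : bset F.
Hypotheses (stratU : strategic U) (pplusU : pplus_filter U).

Let filterU : Defs.filter U := pplusU.1.
Let pU : property_p U := pplusU.2.2.

Variable O : (nat -> bool) -> seq (vec F) -> Prop.

Definition good (w : seq (vec F)) (r : btree) : Prop :=
  exists2 Y, U Y & forall f, branch r f -> exists tau, wins (O f) Y w tau.

Lemma goodW w r r' : good w r -> tree_le r' r -> good w r'.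
Proof. by move=> [Y UY h] le; exists Y => // f /(branchW le); apply: h. Qed.

Lemma open_dichotomy q x :
  perfect_tree q -> (forall w, decided_on q (O^~ w)) ->
  exists r Y, [/\ perfect_tree r, tree_le r q, U Y &
    (exists sigma, forall f, branch r f -> forall Z, play_F x Y sigma Z ->
       forall k, size x <= k -> ~ O f (mkseq Z k)) \/
    (forall f, branch r f -> exists tau, wins (O f) Y x tau)].
Proof.
move=> qP Odec.
have [|q1 [q1P q1q gooddec goodm]] := @fusion_forces (seq (vec F)) q good qP.
  by move=> w r r' h _; apply: goodW.
have [X UX] := filterU.1.1.
have [|Y1 [[UY1 _] hY1]] := @diagonal_lower_bound F U filterU pU (seq (vec F) * seq bool)%type
   (fun wt Y => forall f, branch (subtree q1 wt.2) f -> exists tau, wins (O f) Y wt.1 tau) X UX.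
  move=> wt Y Y' h Y'Y f /h [tau w]; exists tau; exact: wins_star_closed w Y'Y.
pose bad f w := ~ forces q1 (good w) f.
have goodY1 f w : branch q1 f -> forces q1 (good w) f -> exists tau, wins (O f) Y1 w tau.
  move=> qf [m g]; apply: (hY1 (w, mkseq f m)) => //.
  exact: branch_subtree.
(* A position in [O f] is won by [Done], and by [Odec] also for all branches near [f], so it is
   good. *)
have badO f w : branch q1 f -> bad f w -> ~ O f w.
  move=> qf bf Of; apply: bf; have [m hm] := Odec w.
  exists m, Y1 => // f' qf'; exists Done => /=.
  apply: hm Of; first exact: branchW q1q qf.
    exact: branchW q1q (branchW (@subtreeW _ _) qf').
  exact: subtree_branch_agree qf'.
pose D w f v := legal_next w v -> bad f (rcons w v).
have Ddec w v : decided_on q1 (fun f => D w f v).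
  have [m hm] := decided_on_not (gooddec (rcons w v)).
  by exists m => f f' qf qf' ff' Dv /Dv; apply: hm.
pose escapes w r Y := forall f, branch r f -> forall Z, blockseq Z -> tle Z Y ->
  exists2 v, inspan Z v & ~ D w f v.
pose E w r Y := almost Y (fun v => forall f, branch r f -> D w f v) \/ escapes w r Y.
have Estar w r : star_closed (E w r).
  move=> Y Y' [h|h] Y'Y; [left; exact: almost_star_closed h Y'Y|right].
  by move=> f rf Z bZ ZY'; apply: h => //; apply: tle_trans Y'Y.
have [||q2 [q2P q2q1 Em]] := @fusion_decide (seq (vec F)) q1
   (fun w r => exists2 Y, U Y & E w r Y) q1P.
- move=> w r r' [Y UY h] _ le; exists Y => //; case: h => [[n hn]|h]; [left|right].
    by exists n => v Yv av f /(branchW le); apply: hn.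
  by move=> f /(branchW le); apply: h.
- move=> w r rP rq1; have [|r' [Y [r'P r'r UY h]]] := parametrized_fullness stratU pplusU (D := D w) rP.
    by move=> v; apply: decided_onW (Ddec w v).
  exists r'; split=> //; exists Y => //; case: h => [h|h]; [left|by right].
  by exists 0 => v Yv _ f rf; apply: h.
have [|Y2 [[UY2 Y2Y1] hY2]] := @diagonal_lower_bound F U filterU pU (seq (vec F) * seq bool)%type
   (fun wt => E wt.1 (subtree q2 wt.2)) Y1 UY1.
  by move=> wt; apply: Estar.
(* Bad positions stay bad under all late moves in [Y2]. Otherwise [w] escapes: near [f], every [Z]
   below [Y2] contains a move to a good position, so II wins from [w] by making it first, and [w]
   would be good. *)
have key w : exists n, forall f, branch q2 f -> bad f w ->
    forall v, inspan Y2 v -> above n v -> D w f v.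
  have [m hm] := Em w; have [m1 hm1] := goodm w.
  have [|t tm|n hn] := @finite_level_bound_nat (fun t n => q2 t ->
     (forall v, inspan Y2 v -> above n v -> forall f, branch (subtree q2 t) f -> D w f v) \/
     escapes w (subtree q2 t) Y2) m.
  - move=> t n n' h nn' /h [h'|]; last by right.
    by left=> v Yv av; apply: h' => //; apply: aboveW av.
  - case: (EM (q2 t)) => qt; last by exists 0.
    case: (hY2 (w, t) (hm t qt tm)) => /= [[n hn]|h]; last by exists 0; right.
    by exists n; left.
  exists n => f q2f bf v Yv av.
  have q1f := branchW q2q1 q2f.
  have [h|esc] := hn (mkseq f m) (size_mkseq _ _) (q2f m).
    by apply: h => //; apply: branch_subtree.
  have gw : good w (subtree q2 (mkseq f m)).
    exists Y2 => // f' qf'; apply: wins_intro => Z bZ ZY2.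
    have [z Zz /not_implyP [nz /contrapT g]] := esc f' qf' Z bZ ZY2.
    have q1f' := branchW q2q1 (branchW (@subtreeW _ _) qf').
    have [tau win] := goodY1 f' _ q1f' g.
    by exists z, tau; split=> //; apply: wins_star_closed win (tle_ble Y2Y1).
  have [_ /(_ bf (subtree q2 (mkseq f (maxn m m1))))] := hm1 f q1f.
  case.
  - exact: perfect_subtree.
  - apply: tree_le_trans (subtreeS q2q1).
    by apply: subtree_mono; rewrite leq_maxr.
  - by apply: goodW gw _; apply: subtree_mono; rewrite leq_maxl.
case: (EM (exists2 f, branch q2 f & forces q1 (good x) f)) => [[f q2f [m [Y UY h]]]|nex].
  exists (subtree q2 (mkseq f m)), Y; split=> //.
  - exact: perfect_subtree.
  - exact: tree_le_trans (@subtreeW _ _) (tree_le_trans q2q1 q1q).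
  - by right=> f' /(branchW (subtreeS q2q1)); apply: h.
have /choice [sigma hsigma] := key.
exists q2, Y2; split=> //; first exact: tree_le_trans q2q1 q1q.
left; exists sigma => f q2f Z [Zx hZ] k xk.
apply: badO; first exact: branchW q2q1 q2f.
rewrite -(subnKC xk); elim: (k - size x) => [|j IH].
  by rewrite addn0 Zx => g; apply: nex; exists f.
rewrite addnS mkseqS; have [h1 h2 h3] := hZ (size x + j) (leq_addr _ _).
exact: hsigma IH _ h2 h3 h1.
Qed.

End OpenGames.

(** * Analytic sets *)

Section Analytic.
Variable F : countFieldType.
Local Notation bseq := (nat -> vec F).

Lemma play_F_weaken x w (Y Y' : bseq) sigma sigma' (Z : bseq) :
  play_F x Y sigma Z -> mkseq Z (size w) = w -> size x <= size w ->
  (forall k, size w <= k -> inspan Y (Z k) -> above (sigma (mkseq Z k)) (Z k) ->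
     inspan Y' (Z k) /\ above (sigma' (mkseq Z k)) (Z k)) ->
  play_F w Y' sigma' Z.
Proof.
move=> [_ hZ] Zw xw h; split=> // k wk.
have [h1 h2 h3] := hZ k (leq_trans xw wk).
by have [] := h k wk h2 h3.
Qed.

Lemma play_F_tle x (Y Y' : bseq) sigma : tle Y' Y ->
  exists sigma', forall Z, play_F x Y' sigma' Z -> play_F x Y sigma Z.
Proof.
move=> [n hn]; exists (fun w => maxn n (sigma w)) => Z pZ.
apply: (play_F_weaken pZ) => //; first exact: pZ.1.
move=> k _ Yk ak; split.
  by apply: hn => //; apply: aboveW ak; rewrite leq_maxl.
by apply: aboveW ak; rewrite leq_maxr.
Qed.

Lemma play_F_outcome xs (Y : bseq) sigma Z :
  outcomesI_F xs Y (fun ys => sigma (xs ++ ys)) Z -> play_F xs Y sigma Z.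
Proof.
move=> [ys [hys /funext ->]]; split.
  by rewrite -[size xs]addn0 mkseq_concat cats0.
move=> k /subnKC <-; rewrite mkseq_concat.
have -> : concat_seq xs ys (size xs + (k - size xs)) = ys (k - size xs).
  by rewrite /concat_seq ltnNge leq_addr addKn.
have [h1 [h2 [h3 [h4 h5]]]] := hys (k - size xs); split=> //; split=> // x.
rewrite mem_cat => /orP [/h4 //|/mapP [i]].
by rewrite mem_iota => /= ik ->; apply: h5.
Qed.

Variable U : bset F.
Hypotheses (stratU : strategic U) (pplusU : pplus_filter U).

Let filterU : Defs.filter U := pplusU.1.
Let pU : property_p U := pplusU.2.2.

Variable g : (nat -> nat) -> pt F.
Hypothesis gcont : baire_continuous g.

Definition avoids (xs : seq (vec F) * seq nat) (r : btree) (sigma : seq (vec F) -> nat) (Y : bseq) : Prop :=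
  forall f, branch r f -> forall Z, play_F xs.1 Y sigma Z ->
    forall a, mkseq a (size xs.2) = xs.2 -> g a <> (f, Z).

Definition avoidable xs r : Prop := exists2 Y, U Y & exists sigma, avoids xs r sigma Y.

Lemma avoidsW xs r r' sigma Y : avoids xs r sigma Y -> tree_le r' r -> avoids xs r' sigma Y.
Proof. by move=> h le f /(branchW le); apply: h. Qed.

Lemma avoidableW xs r r' : avoidable xs r -> tree_le r' r -> avoidable xs r'.
Proof.
by move=> [Y UY [sigma h]] le; exists Y => //; exists sigma; apply: avoidsW h le.
Qed.

Lemma avoids_star_closed xs r : star_closed (fun Y => exists sigma, avoids xs r sigma Y).
Proof.
move=> Y Y' [sigma h] Y'Y; have [sigma' h'] := play_F_tle xs.1 sigma Y'Y.
by exists sigma' => f rf Z /h'; apply: h.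
Qed.

Section Decided.
Variables (q1 : btree) (Y1 : bseq).
Hypotheses (q1P : perfect_tree q1) (UY1 : U Y1).
Hypothesis av_dec : forall xs, decided_on q1 (forces q1 (avoidable xs)).
Hypothesis av_level : forall xs, exists m, forall f, branch q1 f ->
  (forces q1 (avoidable xs) f -> avoidable xs (subtree q1 (mkseq f m))) /\
  (~ forces q1 (avoidable xs) f -> forall r, perfect_tree r ->
     tree_le r (subtree q1 (mkseq f m)) -> ~ avoidable xs r).
Hypothesis Y1_avoids : forall xs t, avoidable xs (subtree q1 t) ->
  exists sigma, avoids xs (subtree q1 t) sigma Y1.

Local Notation av f xs := (forces q1 (avoidable xs) f).

(** A pointwise larger strategy leaves II fewer plays, so the maximum over the finitely many nodes
    of the deciding level avoids for all [f] at once. *)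
Lemma uniform_avoiding_strategy xs : exists sigma, forall f, branch q1 f -> av f xs ->
  forall Z, play_F xs.1 Y1 sigma Z ->
  forall a, mkseq a (size xs.2) = xs.2 -> g a <> (f, Z).
Proof.
have [m hm] := av_level xs.
have [||t tm|sigma hsigma] := @finite_level_bound (seq (vec F) -> nat)
   (fun s s' => forall w, s w <= s' w)
   (fun t sigma => avoidable xs (subtree q1 t) -> avoids xs (subtree q1 t) sigma Y1)
   (fun=> 0) m.
- move=> s s'; exists (fun w => maxn (s w) (s' w)).
  by split=> w; rewrite ?leq_maxl ?leq_maxr.
- move=> t s s' h ss' /h {}h f tf Z pZ; apply: h => //.
  apply: (play_F_weaken pZ) => //; first exact: pZ.1.
  by move=> k _ Yk ak; split=> //; apply: aboveW ak.
- case: (EM (avoidable xs (subtree q1 t))) => [/Y1_avoids [s h]|h]; last by exists (fun=> 0).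
  by exists s.
exists sigma => f q1f /(proj1 (hm f q1f)) /(hsigma _ (size_mkseq _ _)); apply.
exact: branch_subtree.
Qed.

(* II's goal after [xs = (x, s)]: reach a position, properly extending [x],
   from which I cannot avoid the part of the analytic set coded by some
   one-point extension of [s]. *)
Definition progress (xs : seq (vec F) * seq nat) (f : nat -> bool) (w : seq (vec F)) : Prop :=
  size xs.1 < size w /\ exists2 n, n < size w & ~ av f (w, rcons xs.2 n).

(** The bound [n < size w] in [progress] leaves finitely many [n], whose moduli have a maximum. *)
Lemma progress_decided xs w : decided_on q1 (fun f => progress xs f w).
Proof.
have /choice [m hm] := fun n => decided_on_not (av_dec (w, rcons xs.2 n)).
exists (\max_(n < size w) m n)%N => f f' qf qf' ff' [xw [n nw nav]].
split=> //; exists n => //; apply: hm qf qf' _ nav.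
by apply: agree_uptoW ff'; apply: (leq_bigmax (Ordinal nw)).
Qed.

Definition blocks_progress xs r sigma Y : Prop :=
  forall f, branch r f -> forall Z, play_F xs.1 Y sigma Z ->
    forall k, size xs.1 <= k -> ~ progress xs f (mkseq Z k).

(* I blocks all progress from [(x, s)] and, at each later position [w], begins
   to avoid the part coded by [s n] for every [n < size w]. *)
Lemma blocks_progress_avoidable xs r sigma Y :
  tree_le r q1 -> U Y -> ble Y Y1 -> blocks_progress xs r sigma Y -> avoidable xs r.
Proof.
case: xs => x s rq1 UY YY1 blk; have /choice [sig hsig] := uniform_avoiding_strategy.
pose later w := (\max_(k < (size w).+1) \max_(n < size w) sig (take k w, rcons s n) w)%N.
exists Y => //; exists (fun w => maxn (sigma w) (later w)).
move=> f rf Z pZ a /= as_ ga.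
have pZ' : play_F x Y sigma Z.
  apply: (play_F_weaken pZ) => //; first exact: pZ.1.
  by move=> k _ Yk ak; split=> //; apply: aboveW ak; rewrite leq_maxl.
(* [n] is the next entry of the code, and [k] is a length beyond [x] exceeding [n]. Since progress
   is blocked, [(mkseq Z k, rcons s n)] is avoidable, and from length [k] on [later] dominates the
   strategy avoiding it. *)
pose n := a (size s); pose k := (maxn (size x) n).+1.
have xk : size x < k by rewrite ltnS leq_maxl.
have nk : n < k by rewrite ltnS leq_maxr.
have avw : av f (mkseq Z k, rcons s n).
  apply: contrapT => nav; apply: (blk f rf Z pZ' k (ltnW xk)).
  by split; rewrite size_mkseq //; exists n.
suff pw : play_F (mkseq Z k) Y1 (sig (mkseq Z k, rcons s n)) Z.
  by apply: (hsig _ f (branchW rq1 rf) avw Z pw a) ga; rewrite size_rcons mkseqS as_.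
apply: (play_F_weaken pZ); rewrite size_mkseq //; first exact: ltnW.
move=> j kj Yj aj; split; first exact: YY1.
apply: aboveW aj; apply: leq_trans (leq_maxr _ _).
have kj' : k < (size (mkseq Z j)).+1 by rewrite size_mkseq.
have nj' : n < size (mkseq Z j) by rewrite size_mkseq; apply: leq_trans kj.
apply: leq_trans (leq_bigmax (Ordinal kj')); apply: leq_trans (leq_bigmax (Ordinal nj')).
by rewrite /= take_mkseq.
Qed.

Section Outcome.
Variables (q2 : btree) (Y : bseq) (f : nat -> bool).
Hypothesis makes_progress : forall xs, ~ av f xs ->
  exists tau, wins (progress xs f) Y xs.1 tau.

(** If no code extending [s] gave such a point, the constant strategy would avoid on the whole
    neighbourhood of [f] of length [m]. *)
Lemma approximate_code x s m : ~ av f (x, s) ->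
  exists b f' Z', [/\ g b = (f', Z'), mkseq b (size s) = s, agree_upto m f f' &
    mkseq Z' (size x) = x].
Proof.
move=> nav; apply: contrapT => nex; apply: nav; exists m, Y1 => //.
exists (fun=> 0) => f' qf' Z' pZ' b bs gb; apply: nex; exists b, f', Z'; split=> //.
  exact: subtree_branch_agree qf'.
exact: pZ'.1.
Qed.

(* The current position, the code [s] found so far, the position at which [s]
   was last extended, and what remains of the current open strategy. *)
Let state : Type := (seq (vec F) * seq nat * seq (vec F) * wtree F)%type.

Let inv (S : state) : Prop := let: (w, s, x, tau) := S in
  [/\ ~ av f (x, s), prefix x w, tau <> Done F & wins (progress (x, s) f) Y w tau].

Let step (S S' : state) : Prop :=
  let: (w, s, x, tau) := S in let: (w', s', x', tau') := S' in
  [/\ s' = s, x' = x & exists h c Z, tau = Play h c /\ tau' = c Z] \/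
  (exists n, s' = rcons s n) /\ x' = w'.

Lemma start_strategy x s : ~ av f (x, s) ->
  exists2 tau, tau <> Done F & wins (progress (x, s) f) Y x tau.
Proof.
move=> nav; have [tau win] := makes_progress nav; exists tau => // tauD.
by move: win; rewrite tauD /= => -[]; rewrite ltnn.
Qed.

Lemma states_code (Z : bseq) m0 (st : nat -> state) :
  (forall k, [/\ inv (st k), (st k).1.1.1 = mkseq Z (m0 + k) & step (st k) (st k.+1)]) ->
  exists a, g a = (f, Z).
Proof.
move=> hst.
pose w k := (st k).1.1.1; pose s k := (st k).1.1.2.
pose x k := (st k).1.2; pose tau k := (st k).2.
have stE k : st k = (w k, s k, x k, tau k) by rewrite /w /s /x /tau; case: (st k) => [[[]]].
have invk k : [/\ ~ av f (x k, s k), prefix (x k) (w k) & tau k <> Done F].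
  by have [] := hst k; rewrite stE => -[].
have wE k : w k = mkseq Z (m0 + k) by have [] := hst k.
have stepk k : [/\ s k.+1 = s k, x k.+1 = x k & exists h c Z, tau k = Play h c /\ tau k.+1 = c Z] \/
    (exists n, s k.+1 = rcons (s k) n) /\ x k.+1 = w k.+1.
  by have [_ _] := hst k; rewrite !stE.
have xw k : size (x k) <= size (w k) by have [_ /size_prefix] := invk k.
(* Induction on the well-founded strategy: it cannot be followed forever, so the code is eventually
   extended. *)
have advance t k : tau k = t -> exists j, size (s k) < size (s j) /\ size (x k) < size (x j).
  elim: t k => [|h c IH] k tk; first by have [_ _ []] := invk k.
  have [[sk xk [h' [c' [W [tk' tk1]]]]]|[[n sk] xk]] := stepk k.
    have tc : tau k.+1 = c W by move: tk'; rewrite tk => -[_ ->].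
    by have [j] := IH W k.+1 tc; rewrite sk xk => ?; exists j.
  exists k.+1; rewrite sk xk size_rcons ltnS leqnn; split=> //.
  by apply: leq_ltn_trans (xw k) _; rewrite !wE !size_mkseq addnS.
have /choice [J hJ] : forall n, exists j, n <= size (s j) /\ n <= size (x j).
  elim=> [|n [j [nj nj']]]; first by exists 0.
  have [j' [h h']] := advance _ j erefl.
  by exists j'; split; [exact: leq_ltn_trans h|exact: leq_ltn_trans h'].
have spre k j : prefix (s k) (s (k + j)).
  elim: j => [|j IH]; rewrite ?addn0 ?prefix_refl // addnS.
  by have [[-> _ _]|[[n ->] _]] := stepk (k + j) => //; apply: prefix_trans IH (prefix_rcons _ _).
have snth k j i : i < size (s k) -> i < size (s j) -> nth 0 (s k) i = nth 0 (s j) i.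
  wlog kj : k j / k <= j.
    by move=> h ik ij; case: (leqP k j) => kj; [exact: h|apply/esym/h => //; exact: ltnW].
  move=> ik _; have := spre k (j - k); rewrite subnKC // prefixE => /eqP <-.
  by rewrite nth_take.
pose a i := nth 0 (s (J i.+1)) i.
have aE j : mkseq a (size (s j)) = s j.
  apply: (@eq_from_nth _ 0); rewrite size_mkseq // => i ij.
  by rewrite nth_mkseq // /a; apply: snth => //; have [] := hJ i.+1.
exists a.
suff ga i : f i = (g a).1 i /\ Z i = (g a).2 i.
  rewrite [g a]surjective_pairing; by congr pair; apply: funext => i; have [fi Zi] := ga i.
(* By continuity [g a] agrees at [i] with [g b] for any [b] sharing a long part of the code;
   [approximate_code] supplies such a [b] with [g b] agreeing with [(f, Z)] at [i]. *)
have [m hm] := gcont a i.+1; pose j := J (maxn m i.+1).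
have [js jx] := hJ (maxn m i.+1).
have [nav /prefixP [u wu] _] := invk j.
have [b [f' [Z' [gb bs ff' Z'x]]]] := approximate_code i.+1 nav.
have ab : forall i0, i0 < m -> b i0 = a i0.
  have : agree_upto (size (s j)) b a by apply: mkseq_agree_upto; rewrite bs aE.
  by apply: agree_uptoW; apply: leq_trans js; rewrite leq_maxl.
have [] := hm b ab i (ltnSn i); rewrite gb /= => <- <-; split; first exact: ff'.
have ix : i < size (x j) by apply: leq_trans jx; rewrite leq_maxr.
have : mkseq Z (size (x j)) = mkseq Z' (size (x j)).
  have xsz := xw j; rewrite wE size_mkseq in xsz.
  by rewrite Z'x -(take_mkseq Z xsz) -wE wu take_size_cat.
by move/mkseq_agree_upto; apply.
Qed.

(** II follows an open strategy until it reaches [Done], appends to the code the [n] supplied by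
    [progress], and starts a new open strategy from the current position. *)
Lemma strategy_into_analytic x : ~ av f (x, [::]) ->
  exists alpha, is_stratII_G x Y alpha /\
    forall Z, outcomeII_G x Y alpha Z -> exists a, g a = (f, Z).
Proof.
move=> nav; have [tau0 tau0D win0] := start_strategy nav.
have [||alpha [stalpha out]] := @stratII_build F state (x, [::], x, tau0)
   (fun S => S.1.1.1) step inv Y.
- by split=> //; rewrite prefix_refl.
- move=> [[[w s] y] [|h c]] Z [] //= nav' yw _ win bZ ZY.
  have [Zz nz] := win Z bZ (tle_ble ZY).
  case cZ: (c Z) => [|h' c'] win'.
    have [_ [n _ nav'']] := win'; have [tau tauD win''] := start_strategy nav''.
    exists (h Z), (rcons w (h Z), rcons s n, rcons w (h Z), tau); split=> //=.
      by split=> //; rewrite prefix_refl.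
    by right; split=> //; exists n.
  exists (h Z), (rcons w (h Z), s, y, c Z); rewrite cZ; split=> //=.
    by split=> //; apply: prefix_trans yw (prefix_rcons _ _).
  by left; split=> //; exists h, c, Z; rewrite cZ.
exists alpha; split=> // Z /out [st [_ hst]].
exact: states_code hst.
Qed.

End Outcome.

(** [open_dichotomy] is fused over all [xs]. Its alternative for I would make [xs] avoidable near
    [f] by [blocks_progress_avoidable], so a non-avoidable [xs] leaves only the alternative for
    II. *)
Lemma decide_progress : exists q2 Y2,
  [/\ perfect_tree q2, tree_le q2 q1, U Y2 & forall f, branch q2 f ->
     forall xs, ~ av f xs -> exists tau, wins (progress xs f) Y2 xs.1 tau].
Proof.
pose E xs r Y := (exists sigma, blocks_progress xs r sigma Y) \/
  (forall f, branch r f -> exists tau, wins (progress xs f) Y xs.1 tau).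
have Estar xs r : star_closed (E xs r).
  move=> Y Y' [[sigma h]|h] Y'Y.
    left; have [sigma' h'] := play_F_tle xs.1 sigma Y'Y.
    by exists sigma' => f rf Z /h'; apply: h.
  right=> f /h [tau w]; exists tau; exact: wins_star_closed w Y'Y.
have [||q2 [q2P q2q1 Em]] := @fusion_decide (seq (vec F) * seq nat)%type q1
   (fun xs r => exists2 Y, U Y & E xs r Y) q1P.
- move=> xs r r' [Y UY h] _ le; exists Y => //; case: h => [[sigma h]|h]; [left|right].
    by exists sigma => f /(branchW le); apply: h.
  by move=> f /(branchW le); apply: h.
- move=> xs r rP rq1; have [|r' [Y [r'P r'r UY h]]] :=
      open_dichotomy stratU pplusU (O := progress xs) xs.1 rP.
    by move=> w; apply: decided_onW rq1 (progress_decided _ _).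
  by exists r'; split=> //; exists Y.
have [|Y2 [[UY2 Y2Y1] hY2]] := @diagonal_lower_bound F U filterU pU
   ((seq (vec F) * seq nat) * seq bool)%type
   (fun xt => E xt.1 (subtree q2 xt.2)) Y1 UY1.
  by move=> xt; apply: Estar.
exists q2, Y2; split=> // f q2f xs nav.
have [m hm] := Em xs; have [m1 hm1] := av_level xs.
have [[sigma blk]|] := hY2 (xs, mkseq f m) (hm _ (q2f m) (size_mkseq _ _)); last first.
  by apply; apply: branch_subtree.
have avr : avoidable xs (subtree q2 (mkseq f m)).
  by apply: blocks_progress_avoidable blk => //; apply: tree_le_trans q2q1; apply: subtreeW.
have [_ /(_ nav (subtree q2 (mkseq f (maxn m m1))))] := hm1 f (branchW q2q1 q2f).
case.
- exact: perfect_subtree.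
- apply: tree_le_trans (subtreeS q2q1).
  by apply: subtree_mono; rewrite leq_maxr.
- by apply: avoidableW avr _; apply: subtree_mono; rewrite leq_maxl.
Qed.

End Decided.

Lemma continuous_image_dichotomy xs X p :
  U X -> perfect_tree p -> exists Y q,
  [/\ restr U X Y, perfect_tree q, tree_le q p &
    (exists sigma, avoids (xs, [::]) q sigma Y) \/
    (forall f, branch q f -> exists alpha, is_stratII_G xs Y alpha /\
       forall Z, outcomeII_G xs Y alpha Z -> exists a, g a = (f, Z))].
Proof.
move=> UX pP.
have [|q1 [q1P q1p dec lev]] := @fusion_forces (seq (vec F) * seq nat)%type p avoidable pP.
  by move=> i r r' h _; apply: avoidableW.
have [|Y1 [[UY1 Y1X] hY1]] := @diagonal_lower_bound F U filterU pU
   ((seq (vec F) * seq nat) * seq bool)%type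
   (fun xt Y => exists sigma, avoids xt.1 (subtree q1 xt.2) sigma Y) X UX.
  by move=> xt; apply: avoids_star_closed.
have Y1av ys t : avoidable ys (subtree q1 t) -> exists sigma, avoids ys (subtree q1 t) sigma Y1.
  by move=> h; apply: (hY1 (ys, t)).
(* One branch forcing avoidability of the initial position gives I a strategy on a whole subtree;
   otherwise II wins for every branch. *)
case: (EM (exists2 f, branch q1 f & forces q1 (avoidable (xs, [::])) f)) => [[f q1f [m h]]|nex].
  exists Y1, (subtree q1 (mkseq f m)); split=> //.
  - exact: perfect_subtree.
  - exact: tree_le_trans (@subtreeW _ _) q1p.
  - by left; apply: Y1av.
have [q2 [Y2 [q2P q2q1 UY2 win]]] := decide_progress q1P UY1 dec lev Y1av.
have [Y [UY [YX YY2]]] := filterU.2 _ _ UX UY2.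
exists Y, q2; split=> //; first exact: tree_le_trans q1p.
right=> f q2f.
apply: (strategy_into_analytic (q1 := q1) UY1); last by move=> h; apply: nex; exists f => //; exact: branchW q2q1 q2f.
move=> ys nav; have [tau w] := win f q2f ys nav; exists tau.
exact: wins_star_closed w (tle_ble YY2).
Qed.

End Analytic.

Theorem theorem7p6 (F : countFieldType) (U : bset F) :
  strategic U -> pplus_filter U ->
  forall A : pt F -> Prop,
    (forall z, A z -> blockseq z.2) ->
    analytic A ->
    perfectly_strat_Ramsey U A.
Proof.
move=> stratU pplusU A _ anA xs X p _ UX pP.
case: anA => [A0|[g [gcont [gA Ag]]]].
  exists X, p; do !split=> //.
  by left; exists (fun=> 0) => f Z _ _; apply: A0.
have [Y [q [UY qP qp h]]] := continuous_image_dichotomy stratU pplusU gcont xs UX pP.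
exists Y, q; split=> //; split=> //; split=> //; case: h => [[sigma av]|win]; [left|right].
  (* In [outcomesI_F] a strategy sees only II's moves, whereas [sigma] expects the whole
     position. *)
  exists (fun ys => sigma (xs ++ ys)) => f Z qf /play_F_outcome pZ /Ag [a].
  exact: (av f qf Z pZ a).
move=> f /win [alpha [stalpha out]]; exists alpha; split=> // Z /out [a <-].
exact: gA.
Qed.
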